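(* Let $\mathcal{L}_0:\mathbb{R}^d\to\overline{\mathbb{R}}$ be defined by $$\mathcal{L}_0(x)=\sup_{y\in\mathbb{R}^d}\Big(\langle x,y\rangle-\sup_{l=0,1,\ldots,d}\big[\|y\|^{tn}_{(l)}-l\big]\Big),\qquad x\in\mathbb{R}^d.$$ Then: 1. $\mathcal{L}_0$ is a proper convex lower semicontinuous function on $\mathbb{R}^d$. 2. $\ell_0$ coincides with $\mathcal{L}_0$ on the Euclidean unit sphere $\mathbb{S}$: $\ell_0(x)=\mathcal{L}_0(x)$ for all $x\in\mathbb{S}$. 3. As a consequence, $\ell_0(x)=\mathcal{L}_0\big(x/\|x\|\big)$ for all $x\in\mathbb{R}^d\setminus\{0\}$. 4. $\mathcal{L}_0(x_1,\ldots,x_d)=\mathcal{L}_0(|x_1|,\ldots,|x_d|)$ for all $(x_1,\ldots,x_d)\in\mathbb{R}^d$.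
   Context: $d\geq 1$ is an integer; $\mathbb{R}^d$ carries the scalar product $\langle\cdot,\cdot\rangle$ and the Euclidean norm $\|\cdot\|$; $\mathbb{S}=\{x:\|x\|=1\}$; $\overline{\mathbb{R}}=[-\infty,+\infty]$. A function is proper if it never takes the value $-\infty$ and is not identically $+\infty$. $\ell_0(x)$ is the number of nonzero components of $x\in\mathbb{R}^d$. For $K\subset\{1,\ldots,d\}$, $x_K$ is the vector that coincides with $x$ on indices in $K$ and vanishes on indices outside $K$. For $k\in\{1,\ldots,d\}$ the top-$k$ norm is $\|x\|^{tn}_{(k)}=\sup_{|K|\leq k}\|x_K\|$, the supremum being over subsets $K$ of $\{1,\ldots,d\}$; by convention $\|\cdot\|^{tn}_{(0)}=0$. *)

(* Defs.v *)
From HB Require Import structures.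
From mathcomp Require Import all_boot all_order all_algebra.
From mathcomp Require Import all_classical all_reals all_analysis.
Set Implicit Arguments.
Unset Strict Implicit.
Unset Printing Implicit Defensive.
Import Order.TTheory GRing.Theory Num.Theory.
Import numFieldNormedType.Exports.
Local Open Scope classical_set_scope.
Local Open Scope ring_scope.

Definition dotp (R : realType) (d : nat) (x y : 'rV[R]_d) : R :=
  \sum_(i < d) x 0 i * y 0 i.

(* The library norm [`|x|] on row vectors is the sup norm, hence this
   definition.  The library topology on ['rV[R]_d] is the product topology,
   which is the one induced by the Euclidean norm. *)
Definition enorm (R : realType) (d : nat) (x : 'rV[R]_d) : R :=
  Num.sqrt (dotp x x).

Definition usphere (R : realType) (d : nat) : set 'rV[R]_d :=
  [set x | enorm x = 1].

Definition l0 (R : realType) (d : nat) (x : 'rV[R]_d) : nat :=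
  #|[set i : 'I_d | x 0 i != 0]%SET|.

Definition vrestr (R : realType) (d : nat) (K : {set 'I_d}) (x : 'rV[R]_d)
    : 'rV[R]_d :=
  \row_(i < d) if i \in K then x 0 i else 0.

(* For [k = 0] the only admissible [K] is empty, so that the value is [0],
   as in the usual convention. *)
Definition topk_norm (R : realType) (d k : nat) (x : 'rV[R]_d) : R :=
  sup [set enorm (vrestr K x) | K in [set K : {set 'I_d} | (#|K| <= k)%N]].

Definition L0 (R : realType) (d : nat) (x : 'rV[R]_d) : \bar R :=
  ereal_sup [set (dotp x y
                  - sup [set topk_norm l y - l%:R | l in [set l | (l <= d)%N]])%:E
            | y in [set: 'rV[R]_d]].

Definition proper_fun (R : realType) (T : Type) (f : T -> \bar R) : Prop :=
  (forall x, f x != -oo%E) /\ (exists x, f x != +oo%E).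

Definition epigraph (R : realType) (E : lmodType R) (f : E -> \bar R)
    : set (E * R^o) :=
  [set p | (f p.1 <= (p.2 : R)%:E)%E].

(* Convexity of an extended-real-valued function: the library's
   [convex_function] only covers finite values. *)
Definition econvex_function (R : realType) (E : lmodType R) (f : E -> \bar R)
    : Prop :=
  convex_set (epigraph f).

(* Main.v *)
(* The function [L0] is the conjugate of [y |-> max_l (||y||_(l) - l)], hence a
   supremum of continuous affine functions.  Let [x] be a unit vector with [l]
   nonzero entries and support [K].  By Cauchy-Schwarz
   [<x,y> = <x,y_K> <= ||y||_(l)], so [L0 x <= l].  Conversely, [||x_K'|| < 1]
   whenever [#|K'| < l], so for [t] large the maximum at [y = t x] is [t - l],
   and [<x, t x> - (t - l) = l]. *)
Require Import Defs.
From mathcomp Require Import all_boot all_order all_algebra.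
From mathcomp Require Import all_classical all_reals all_analysis.
From mathcomp Require Import ring lra.
Import Order.TTheory GRing.Theory Num.Theory.
Import numFieldNormedType.Exports.
Local Open Scope classical_set_scope.
Local Open Scope ring_scope.

(** * Scalar product and Euclidean norm *)

Lemma dotpC {R : realType} {d : nat} (x y : 'rV[R]_d) : dotp x y = dotp y x.
Proof. by apply: eq_bigr => i _; rewrite mulrC. Qed.

Lemma dotpDl {R : realType} {d : nat} (x y z : 'rV[R]_d) :
  dotp (x + y) z = dotp x z + dotp y z.
Proof. by rewrite /dotp -big_split; apply: eq_bigr => i _; rewrite mxE mulrDl. Qed.

Lemma dotpZl {R : realType} {d : nat} (a : R) (x y : 'rV[R]_d) :
  dotp (a *: x) y = a * dotp x y.
Proof. by rewrite /dotp mulr_sumr; apply: eq_bigr => i _; rewrite mxE mulrA. Qed.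

Lemma dotp0l {R : realType} {d : nat} (y : 'rV[R]_d) : dotp 0 y = 0.
Proof. by rewrite -(scale0r 0) dotpZl mul0r. Qed.

Lemma dotp_ge0 {R : realType} {d : nat} (x : 'rV[R]_d) : 0 <= dotp x x.
Proof. by apply: sumr_ge0 => i _; rewrite -expr2 sqr_ge0. Qed.

Lemma dotp_eq0 {R : realType} {d : nat} (x : 'rV[R]_d) :
  (dotp x x == 0) = (x == 0).
Proof.
apply/eqP/eqP => [x0|->]; last by rewrite dotp0l.
apply/rowP => i; rewrite mxE; apply/eqP; rewrite -sqrf_eq0 expr2; apply/eqP.
have /psumr_eq0P := x0; apply=> // j _.
by rewrite -expr2 sqr_ge0.
Qed.

Lemma enorm_ge0 {R : realType} {d : nat} (x : 'rV[R]_d) : 0 <= enorm x.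
Proof. exact: sqrtr_ge0. Qed.

Lemma enorm_sqr {R : realType} {d : nat} (x : 'rV[R]_d) :
  enorm x ^+ 2 = dotp x x.
Proof. by rewrite sqr_sqrtr ?dotp_ge0. Qed.

Lemma enorm_eq0 {R : realType} {d : nat} (x : 'rV[R]_d) :
  (enorm x == 0) = (x == 0).
Proof. by rewrite -sqrf_eq0 enorm_sqr dotp_eq0. Qed.

Lemma enormZ {R : realType} {d : nat} (a : R) (x : 'rV[R]_d) :
  enorm (a *: x) = `|a| * enorm x.
Proof.
by rewrite /enorm dotpZl dotpC dotpZl mulrA -expr2 sqrtrM ?sqr_ge0// sqrtr_sqr.
Qed.

Lemma dotp_le_enorm {R : realType} {d : nat} (x y : 'rV[R]_d) :
  dotp x y <= enorm x * enorm y.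
Proof.
suff cs : dotp x y ^+ 2 <= dotp x x * dotp y y.
  rewrite /enorm -sqrtrM ?dotp_ge0// (le_trans (ler_norm _))// -sqrtr_sqr.
  by rewrite ler_wsqrtr.
have [->|y0] := eqVneq y 0; first by rewrite dotpC !dotp0l expr0n mulr0.
have yy : 0 < dotp y y by rewrite lt_neqAle dotp_ge0 eq_sym dotp_eq0 y0.
(* This vector is [dotp y y] times the component of [x] orthogonal to [y]; its squared norm is
   [c * (c * a - b ^+ 2)]. *)
have := dotp_ge0 (dotp y y *: x + - dotp x y *: y).
rewrite !dotpDl !dotpZl ![dotp _ (_ + _)]dotpC !dotpDl !dotpZl (dotpC y x).
set a := dotp x x; set b := dotp x y; set c := dotp y y => h.
rewrite -subr_ge0 -(pmulr_rge0 _ yy) -/c.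
by rewrite [X in 0 <= X](_ : _ = c * (c * a + - b * b) + - b * (c * b + - b * c));
  [|ring].
Qed.

(** * Restriction to a set of coordinates *)

Lemma dotp_vrestr {R : realType} {d : nat} (K : {set 'I_d}) (x y : 'rV[R]_d) :
  dotp (vrestr K x) y = \sum_(i in K) x 0 i * y 0 i.
Proof.
rewrite [RHS]big_mkcond; apply: eq_bigr => i _; rewrite mxE.
by case: ifP => _ //; rewrite mul0r.
Qed.

Lemma dotp_vrestr2 {R : realType} {d : nat} (K : {set 'I_d}) (x : 'rV[R]_d) :
  dotp (vrestr K x) (vrestr K x) = \sum_(i in K) x 0 i ^+ 2.
Proof.
by rewrite dotp_vrestr; apply: eq_bigr => i Ki; rewrite mxE Ki expr2.
Qed.

Lemma vrestrZ {R : realType} {d : nat} (K : {set 'I_d}) (a : R) (x : 'rV[R]_d) :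
  vrestr K (a *: x) = a *: vrestr K x.
Proof. by apply/rowP => i; rewrite !mxE; case: ifP; rewrite ?mulr0. Qed.

Lemma enorm_vrestr_le {R : realType} {d : nat} (K : {set 'I_d})
    (x : 'rV[R]_d) : enorm (vrestr K x) <= enorm x.
Proof.
apply: ler_wsqrtr; rewrite dotp_vrestr2 [leLHS]big_mkcond /=.
by apply: ler_sum => i _; rewrite -expr2; case: ifP; rewrite // sqr_ge0.
Qed.

(** [K] is too small to contain the support of [x], so the restriction drops a nonzero square from
    the sum. *)
Lemma enorm_vrestr_lt {R : realType} {d : nat} (K : {set 'I_d})
    (x : 'rV[R]_d) : (#|K| < l0 x)%N -> enorm (vrestr K x) < enorm x.
Proof.
move=> Kl; have [i xi Ki] : exists2 i, x 0 i != 0 & i \notin K.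
  apply: contrapT => nex; move: Kl; rewrite ltnNge => /negP; apply.
  apply/subset_leq_card/fintype.subsetP => i; rewrite inE => xi.
  by apply: contrapT => /negP Ki; apply: nex; exists i.
have h : dotp (vrestr K x) (vrestr K x) < dotp x x.
  rewrite dotp_vrestr2 big_mkcond /dotp (bigD1 i)//= [ltRHS](bigD1 i)//=.
  rewrite (negbTE Ki) ltr_leD//; first by rewrite -expr2 exprn_even_gt0.
  by apply: ler_sum => j _; rewrite -expr2; case: ifP; rewrite // sqr_ge0.
by rewrite ltr_sqrt// (le_lt_trans _ h)// dotp_ge0.
Qed.

(** * Top-k norms and the function whose conjugate is taken *)

Lemma topk_norm_ge {R : realType} {d : nat} (k : nat) (K : {set 'I_d})
    (x : 'rV[R]_d) : (#|K| <= k)%N -> enorm (vrestr K x) <= topk_norm k x.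
Proof.
move=> Kk; apply: ub_le_sup; last by exists K.
by exists (enorm x) => _ [L _ <-]; exact: enorm_vrestr_le.
Qed.

Lemma topk_norm_le {R : realType} {d : nat} (k : nat) (x : 'rV[R]_d) (a : R) :
  (forall K : {set 'I_d}, (#|K| <= k)%N -> enorm (vrestr K x) <= a) ->
  topk_norm k x <= a.
Proof.
move=> h; apply: ge_sup; last by move=> _ [K Kk <-]; exact: h.
(* The real [sup] needs a nonempty set; the empty [K] is admissible for every [k]. *)
by exists (enorm (vrestr finset.set0 x)), finset.set0; rewrite //= cards0.
Qed.

(* [L0] is by definition the Fenchel conjugate of this function. *)
Definition topk_penalty {R : realType} {d : nat} (y : 'rV[R]_d) : R :=
  sup [set topk_norm l y - l%:R | l in [set l | (l <= d)%N]].

Lemma topk_penalty_ge {R : realType} {d : nat} (l : nat) (y : 'rV[R]_d) :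
  (l <= d)%N -> topk_norm l y - l%:R <= topk_penalty y.
Proof.
move=> ld; apply: ub_le_sup; last by exists l.
(* [enorm y] bounds every term: it dominates each top-k norm, and subtracting [k] only decreases. *)
exists (enorm y) => _ [k _ <-]; rewrite lerBlDr.
apply: topk_norm_le => K _; rewrite (le_trans (enorm_vrestr_le _ _))//.
by rewrite lerDl.
Qed.

Lemma topk_penalty_le {R : realType} {d : nat} (y : 'rV[R]_d) (a : R) :
  (forall l, (l <= d)%N -> topk_norm l y - l%:R <= a) -> topk_penalty y <= a.
Proof.
move=> h; apply: ge_sup; last by move=> _ [l ld <-]; exact: h.
by exists (topk_norm 0 y - 0%:R), 0%N.
Qed.

(** * The conjugate is proper, convex and lower semicontinuous *)

Lemma L0_ge {R : realType} {d : nat} (x y : 'rV[R]_d) :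
  ((dotp x y - topk_penalty y)%:E <= L0 x)%E.
Proof. by apply: ereal_sup_ubound; exists y. Qed.

Lemma L0_le {R : realType} {d : nat} (x : 'rV[R]_d) (a : \bar R) :
  (forall y, (dotp x y - topk_penalty y)%:E <= a)%E -> (L0 x <= a)%E.
Proof. by move=> h; apply: ge_ereal_sup => _ [y _ <-]; exact: h. Qed.

Lemma topk_penalty_ge0 {R : realType} {d : nat} (y : 'rV[R]_d) :
  0 <= topk_penalty y.
Proof.
apply: le_trans (topk_penalty_ge 0 y (leq0n d)); rewrite subr0.
by apply: le_trans (topk_norm_ge 0 finset.set0 y _); rewrite ?enorm_ge0 ?cards0.
Qed.

Lemma L0_proper {R : realType} {d : nat} : proper_fun (@L0 R d).
Proof.
split=> [x|]; first by rewrite -ltNye (lt_le_trans _ (L0_ge x 0))// ltNye.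
(* At the origin every term of the supremum is [- topk_penalty y], hence at most [0]. *)
exists 0; rewrite -ltey (@le_lt_trans _ _ 0%E) ?ltey//; apply: L0_le => y.
by rewrite dotp0l sub0r lee_fin oppr_le0 topk_penalty_ge0.
Qed.

(** For each [y] the term is affine in [x]: the weights [t] and [1 - t] sum to one, so the constant
    [topk_penalty y] is preserved. *)
Lemma L0_econvex {R : realType} {d : nat} : econvex_function (@L0 R d).
Proof.
move=> p q t; rewrite !inE /epigraph /= => hp hq; apply: L0_le => y.
have := le_trans (L0_ge p.1 y) hp; have := le_trans (L0_ge q.1 y) hq.
rewrite !lee_fin dotpDl !dotpZl => {hp hq} hq hp.
have t0 : 0 <= t%:num by [].
have t1 : 0 <= 1 - t%:num by rewrite subr_ge0.
have := lerD (ler_wpM2l t0 hp) (ler_wpM2l t1 hq).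
rewrite [leLHS](_ : _ = t%:num * dotp p.1 y + (1 - t%:num) * dotp q.1 y
  - topk_penalty y) => [//|]; by ring.
Qed.

Lemma dotp_continuous {R : realType} {d : nat} (y : 'rV[R]_d) :
  continuous (fun x : 'rV[R]_d => dotp x y).
Proof.
apply: continuous_big => [|i _ x]; first exact: add_continuous.
by apply: continuousM; [exact: coord_continuous|exact: cst_continuous].
Qed.

(** If [a < L0 x], a single [y] already gives a term above [a], and continuity of this term keeps it
    above [a] near [x]. *)
Lemma L0_lsc {R : realType} {d : nat} : lower_semicontinuous (@L0 R d).
Proof.
move=> x a /ereal_sup_gt[_ [y _ <-]]; rewrite lte_fin ltrBrDr => axy.
exists [set z : 'rV[R]_d | a + topk_penalty y < dotp z y].
  exact: cvgr_gt (dotp_continuous y x) _ axy.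
move=> z /=; rewrite -ltrBrDr => azy; apply: lt_le_trans (L0_ge z y).
by rewrite lte_fin.
Qed.

(** * Equality with [l0] on the unit sphere *)

Lemma dotp_vrestr_support {R : realType} {d : nat} (x y : 'rV[R]_d) :
  dotp x (vrestr [set i | x 0 i != 0]%SET y) = dotp x y.
Proof.
apply: eq_bigr => i _; rewrite mxE inE; case: eqP => // -> /=.
by rewrite !mul0r.
Qed.

Lemma L0_le_l0 {R : realType} {d : nat} (x : 'rV[R]_d) :
  enorm x = 1 -> (L0 x <= (l0 x)%:R%:E)%E.
Proof.
move=> x1; apply: L0_le => y; rewrite lee_fin lerBlDl -lerBlDr.
have ld : (l0 x <= d)%N by rewrite -[leqRHS]card_ord max_card.
apply: le_trans (topk_penalty_ge _ y ld); rewrite lerB// -dotp_vrestr_support.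
by rewrite (le_trans (dotp_le_enorm _ _))// x1 mul1r topk_norm_ge.
Qed.

Lemma l0_le_L0 {R : realType} {d : nat} (x : 'rV[R]_d) :
  enorm x = 1 -> ((l0 x)%:R%:E <= L0 x)%E.
Proof.
(* [t] must be at least every [term K], so that [t * (1 - enorm (vrestr K x))] reaches [l0 x] for
   each small [K]. The terms being nonnegative, their sum is large enough. *)
move=> x1; pose term (K : {set 'I_d}) : R :=
    (l0 x)%:R / (1 - enorm (vrestr K x)).
pose t := \sum_(K : {set 'I_d} | (#|K| < l0 x)%N) term K.
have gap (K : {set 'I_d}) : (#|K| < l0 x)%N -> 0 < 1 - enorm (vrestr K x).
  by move=> /enorm_vrestr_lt; rewrite x1 subr_gt0.
have term0 (K : {set 'I_d}) : (#|K| < l0 x)%N -> 0 <= term K.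
  by move=> /gap/ltW ?; apply: divr_ge0.
have t0 : 0 <= t by exact: sumr_ge0.
have tge (K : {set 'I_d}) : (#|K| < l0 x)%N -> (l0 x)%:R <= t * (1 - enorm (vrestr K x)).
  move=> Kl; rewrite -ler_pdivrMr ?gap// /t (bigD1 K)//= lerDl.
  by apply: sumr_ge0 => L /andP[/term0].
apply: le_trans (L0_ge x (t *: x)); rewrite lee_fin dotpC dotpZl -enorm_sqr x1.
rewrite expr1n mulr1 lerBrDl -lerBrDr; apply: topk_penalty_le => k _.
rewrite lerBlDr; apply: topk_norm_le => K Kk.
rewrite vrestrZ enormZ ger0_norm//.
(* The goal is [t * enorm (vrestr K x) <= t - l0 x + k]. For small [K] the choice of [t] gives it
   even without [k]; otherwise [k >= l0 x] and the norm is at most one. *)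
have [/tge h|lK] := ltnP #|K| (l0 x).
  have : 0 <= k%:R :> R by []. by lra.
have : (l0 x)%:R <= k%:R :> R by rewrite ler_nat (leq_trans lK).
have : enorm (vrestr K x) <= 1 by rewrite -x1 enorm_vrestr_le.
by nra.
Qed.

Lemma l0E {R : realType} {d : nat} (x : 'rV[R]_d) :
  enorm x = 1 -> (l0 x)%:R%:E = L0 x.
Proof. by move=> x1; apply/le_anti; rewrite l0_le_L0 ?L0_le_l0. Qed.

Lemma l0Z {R : realType} {d : nat} (a : R) (x : 'rV[R]_d) :
  a != 0 -> l0 (a *: x) = l0 x.
Proof.
move=> a0; apply: eq_card => i.
by rewrite !inE mxE mulf_eq0 (negbTE a0).
Qed.

(** * Invariance under sign changes of the coordinates *)

Definition row_mul {R : realType} {d : nat} (s x : 'rV[R]_d) : 'rV[R]_d :=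
  \row_i (s 0 i * x 0 i).

Lemma row_mulK {R : realType} {d : nat} (s x : 'rV[R]_d) :
  (forall i, s 0 i ^+ 2 = 1) -> row_mul s (row_mul s x) = x.
Proof. by move=> s1; apply/rowP => i; rewrite !mxE mulrA -expr2 s1 mul1r. Qed.

Lemma dotp_row_mull {R : realType} {d : nat} (s x y : 'rV[R]_d) :
  dotp (row_mul s x) y = dotp x (row_mul s y).
Proof. by apply: eq_bigr => i _; rewrite !mxE; ring. Qed.

(** Only the squares of the coordinates enter the norms, and the hypothesis makes every entry of [s]
    a sign. *)
Lemma topk_penalty_row_mul {R : realType} {d : nat} (s y : 'rV[R]_d) :
  (forall i, s 0 i ^+ 2 = 1) -> topk_penalty (row_mul s y) = topk_penalty y.
Proof.
move=> s1.
have E K : enorm (vrestr K (row_mul s y)) = enorm (vrestr K y).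
  rewrite /enorm !dotp_vrestr2; congr Num.sqrt; apply: eq_bigr => i _.
  by rewrite mxE exprMn s1 mul1r.
rewrite /topk_penalty /topk_norm; congr sup; apply: eq_imagel => l _.
by congr (sup _ - _); apply: eq_imagel => K _.
Qed.

(** Change of variable [y] to [row_mul s y] in the supremum: the sign change is a self-adjoint
    involution. Applying this twice gives equality. *)
Lemma L0_row_mul_ge {R : realType} {d : nat} (s x : 'rV[R]_d) :
  (forall i, s 0 i ^+ 2 = 1) -> (L0 x <= L0 (row_mul s x))%E.
Proof.
move=> s1; apply: L0_le => y; apply: le_trans (L0_ge _ (row_mul s y)).
by rewrite dotp_row_mull row_mulK// topk_penalty_row_mul.
Qed.

Lemma L0_row_mul {R : realType} {d : nat} (s x : 'rV[R]_d) :
  (forall i, s 0 i ^+ 2 = 1) -> L0 (row_mul s x) = L0 x.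
Proof.
move=> s1; apply/le_anti; rewrite L0_row_mul_ge// andbT.
by rewrite -{2}(row_mulK s x s1) L0_row_mul_ge.
Qed.

Theorem theorem4p1 (R : realType) (d : nat) (hd : (1 <= d)%N) :
  [/\ [/\ proper_fun (@L0 R d), econvex_function (@L0 R d)
        & lower_semicontinuous (@L0 R d)],
      forall x : 'rV[R]_d, @usphere R d x -> ((l0 x)%:R)%:E = L0 x,
      forall x : 'rV[R]_d, x != 0 -> ((l0 x)%:R)%:E = L0 ((enorm x)^-1 *: x)
    & forall x : 'rV[R]_d, L0 x = L0 (\row_(i < d) `|x 0 i|)].
Proof.
split.
- by split; [exact: L0_proper|exact: L0_econvex|exact: L0_lsc].
- exact: l0E.
- move=> x x0; have ex0 : enorm x != 0 by rewrite enorm_eq0.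
  rewrite -(@l0Z _ _ (enorm x)^-1) ?invr_eq0//; apply: l0E.
  by rewrite enormZ ger0_norm ?invr_ge0 ?enorm_ge0// mulVf.
(* The boolean exponent makes [s] the vector of signs of [x], with [1] at zero entries, so that
   [row_mul s x] consists of the absolute values. *)
- move=> x; pose s : 'rV[R]_d := \row_i (-1) ^+ (x 0 i < 0)%R.
  rewrite -(L0_row_mul s x) => [|i]; last by rewrite mxE sqrr_sign.
  by congr L0; apply/rowP => i; rewrite !mxE normrEsign.
Qed.
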